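(* Let $\Omega\subset\mathbb{R}^2$ be a bounded domain. For any polynomial $P_n$ of degree $n$ with $2d\le n\le 2d+1$, $d\ge 1$, write $$P_n(x,y)=\sum_{j=0}^{2d}q_j(x,y)P_{2d,j}(x,y)+\sum_{j=0}^{2d-2}\hat q_j(x,y)P_{2d-2,j}(x,y)+\cdots+\sum_{j=0}^{2}\tilde q_j(x,y)P_{2,j}(x,y)+R(x,y),$$ based on orthogonal polynomials of even degree over $\Omega$, where the residual $R$ and the quotients $q_j,\hat q_j,\dots,\tilde q_j$ are linear polynomials. Write $R(x,y)=ax+by+c$. If $\Omega$ is centrally symmetric, in the sense that $(\pm x,\pm y)\in\Omega$ whenever $(x,y)\in\Omega$, then $$\int_\Omega P_n(x,y)\,dx\,dy=cA_\Omega,$$ where $A_\Omega$ is the area of $\Omega$. Furthermore, if $\Omega$ is a general polygonal domain, then $$\int_\Omega P_n(x,y)\,dx\,dy=a\int_\Omega x\,dx\,dy+b\int_\Omega y\,dx\,dy+cA_\Omega.$$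
   Context: $\mathbb{P}_m$ is the space of real bivariate polynomials of total degree $\le m$. For each $m\ge 1$, $P_{m,0},\dots,P_{m,m}$ is an orthogonal basis, with respect to the inner product $\int_\Omega fg\,dx\,dy$, of $\mathbb{P}_m\ominus\mathbb{P}_{m-1}$, the orthogonal complement of $\mathbb{P}_{m-1}$ in $\mathbb{P}_m$. ''Linear polynomial'' means a real bivariate polynomial of total degree at most $1$. The sums in the expansion run over the even degrees $2d,2d-2,\dots,4,2$. A polygonal domain is a bounded polygon in $\mathbb{R}^2$ with positive area. *)

(* Defs.v *)
From HB Require Import structures.
From mathcomp Require Import all_boot all_order all_algebra.
From mathcomp Require Import all_classical all_reals all_analysis.
(* The notations of mpoly clash with those of mathcomp-analysis. *)
From mathcomp Require mpoly.
Export -(notations) mpoly.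

Set Implicit Arguments.
Unset Strict Implicit.
Unset Printing Implicit Defensive.

Import Order.TTheory GRing.Theory Num.Theory numFieldNormedType.Exports.

Local Open Scope classical_set_scope.
Local Open Scope ring_scope.

(* [mpoly 2 R] is {mpoly R[2]}; the variables x, y have indices 0, 1. *)
Definition eval2 (R : realType) (p : mpoly 2 R) (z : R * R) : R :=
  meval (fun i : 'I_2 => if i == 0 then z.1 else z.2) p.

(* [msize p] is the total degree plus one, and 0 for p = 0. *)
Definition degree_le (R : realType) (m : nat) (p : mpoly 2 R) : Prop :=
  (msize p <= m.+1)%N.

Definition affine_poly (R : realType) (a b c : R) : mpoly 2 R :=
  a *: mpolyX R (mnm1 (0 : 'I_2)) + b *: mpolyX R (mnm1 (1 : 'I_2))
  + mpolyC 2 c.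

Definition leb2 (R : realType) :=
  (@lebesgue_measure R \x @lebesgue_measure R)%E.

Definition integral2 (R : realType) (Omega : set (R * R)) (f : R * R -> R)
    : R :=
  \int[@leb2 R]_(z in Omega) f z.

Definition area (R : realType) (Omega : set (R * R)) : R :=
  fine (leb2 Omega).

(* An open connected set U, possibly together with part of its boundary: this
   covers both open domains (U = Omega) and closed polygons.  Measurability is
   automatic when Omega is open or closed. *)
Definition bounded_domain (R : realType) (Omega : set (R * R)) : Prop :=
  [/\ measurable Omega, bounded_set Omega &
      exists U : set (R * R),
        [/\ open U, connected U, U !=set0, U `<=` Omega
          & Omega `<=` closure U]].

Definition segment2 (R : realType) (u v : R * R) : set (R * R) :=
  [set z | exists2 t : R, 0 <= t <= 1 & z = (1 - t) *: u + t *: v].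

(* The polygon need not be convex, and may have holes. *)
Definition polygonal_domain (R : realType) (Omega : set (R * R)) : Prop :=
  [/\ bounded_domain Omega, 0 < area Omega &
      exists s : seq ((R * R) * (R * R)),
        closure Omega `\` interior Omega =
        \bigcup_(e in [set` s]) segment2 e.1 e.2].

(* The two signs in "(±x, ±y)" are taken together; closure under independent
   sign changes is a stronger condition. *)
Definition centrally_symmetric (R : realType) (Omega : set (R * R)) : Prop :=
  forall x y : R, Omega (x, y) -> Omega (- x, - y).

Definition poly_inner (R : realType) (Omega : set (R * R))
    (f g : mpoly 2 R) : R :=
  integral2 Omega (fun z => eval2 f z * eval2 g z).

(* The orthogonal complement of P_(m-1) in P_m, for m >= 1. *)
Definition in_orth_compl (R : realType) (Omega : set (R * R)) (m : nat)
    (p : mpoly 2 R) : Prop :=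
  degree_le m p /\
  forall g : mpoly 2 R, degree_le m.-1 g -> poly_inner Omega p g = 0.

Definition orthogonal_basis (R : realType) (Omega : set (R * R)) (m : nat)
    (P : 'I_m.+1 -> mpoly 2 R) : Prop :=
  [/\ forall j, in_orth_compl Omega m (P j),
      forall i j, i != j -> poly_inner Omega (P i) (P j) = 0,
      forall c : 'I_m.+1 -> R,
        \sum_(j < m.+1) c j *: P j = 0 -> forall j, c j = 0
    & forall p, in_orth_compl Omega m p ->
        exists c : 'I_m.+1 -> R, p = \sum_(j < m.+1) c j *: P j].

(* [q (2 * k) j] is the quotient multiplying [P (2 * k) j], 1 <= k <= d. *)
Definition even_expansion (R : realType)
    (P : forall m : nat, 'I_m.+1 -> mpoly 2 R) (d : nat) (p : mpoly 2 R)
    (q : forall m : nat, 'I_m.+1 -> mpoly 2 R) (r : mpoly 2 R) : Prop :=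
  [/\ forall k : nat, (1 <= k <= d)%N ->
        forall j : 'I_(2 * k).+1, degree_le 1 (q (2 * k)%N j),
      degree_le 1 r
    & p = \sum_(1 <= k < d.+1) \sum_(j < (2 * k).+1)
            q (2 * k)%N j * P (2 * k)%N j + r].

(* Main.v *)
Require Import Defs.
From mathcomp Require Import all_boot all_order all_algebra.
From mathcomp Require Import all_classical all_reals all_analysis.
From mathcomp Require Import measurable_realfun.

(** The polynomials P_(m,0), ..., P_(m,m) are orthogonal to everything of
    degree below m, and a linear quotient has degree at most 1, which is below
    every even m >= 2.  So each product of a quotient with a P_(2k,j)
    integrates to zero, and the integral of the whole expansion is the integral
    of its residual [a x + b y + c] ([integral2_expansion]).  If the domain is
    symmetric about the origin, the odd part [a x + b y] of the residual also
    integrates to zero ([integral2_odd]), because the plane Lebesgue measure is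
    invariant under [z |-> - z].

    The expansion exists because the homogeneous parts of degree m of the m + 1
    polynomials P_(m,j) form a basis of the (m + 1)-dimensional space of forms
    of degree m.  It suffices that they be independent.  If a combination of
    the P_(m,j) has no terms of degree m, it lies in the polynomials of degree
    below m and is orthogonal to them, hence to itself; a polynomial with
    vanishing square integral over a set with nonempty interior is zero
    ([integral2_sqr_eq0]), and the P_(m,j) are independent.  Consequently
    subtracting a scalar combination of the P_(m,j) lowers the degree of a
    polynomial of degree m ([orthogonal_basis_reduces]).  A monomial of degree
    m + 1 is a variable times a monomial of degree m, so subtracting a
    combination with linear coefficients brings degree m + 1 down to m - 1 in
    one stroke ([reduces_degree_linearly]).  Doing this for
    m = 2d, 2d - 2, ..., 2 leaves a residual of degree at most 1
    ([exists_even_expansion]). *)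

Import Order.TTheory GRing.Theory Num.Theory numFieldNormedType.Exports.

Local Open Scope classical_set_scope.
Local Open Scope ring_scope.

Set Implicit Arguments.
Unset Strict Implicit.
Unset Printing Implicit Defensive.

(** * Degrees of bivariate polynomials *)

Section Algebra.
Variable R : realType.
Implicit Types p q : mpoly 2 R.

Lemma degree_leP m p :
  degree_le m p <-> forall k : multinom 2, (m < mdeg k)%N -> mcoeff k p = 0.
Proof.
split=> [pm k mk|pm].
  by apply: memN_msupp_eq0; apply: msize_mdeg_ge; apply: leq_trans mk.
rewrite /degree_le msizeE; apply/bigmax_leqP_seq => k kp _.
rewrite ltnS leqNgt; apply/negP => /pm pk0.
by move: kp; rewrite mcoeff_msupp pk0 eqxx.
Qed.

Lemma degree_leW m m' p : (m <= m')%N -> degree_le m p -> degree_le m' p.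
Proof. by move=> mm' pm; apply: leq_trans pm _. Qed.

Lemma degree_leD m p q : degree_le m p -> degree_le m q -> degree_le m (p + q).
Proof.
move=> /degree_leP pm /degree_leP qm; apply/degree_leP => k mk.
by rewrite mcoeffD pm// qm// addr0.
Qed.

Lemma degree_leZ m a p : degree_le m p -> degree_le m (a *: p).
Proof.
by move=> /degree_leP pm; apply/degree_leP => k mk; rewrite mcoeffZ pm// mulr0.
Qed.

Lemma degree_le_sum m (I : Type) (s : seq I) (Q : pred I)
    (F : I -> mpoly 2 R) :
  (forall i, Q i -> degree_le m (F i)) ->
  degree_le m (\sum_(i <- s | Q i) F i).
Proof.
move=> Fm; apply: big_ind => //; last exact: degree_leD.
by apply/degree_leP => k _; rewrite mcoeff0.
Qed.

Lemma degree_leM m m' p q :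
  degree_le m p -> degree_le m' q -> degree_le (m + m') (p * q).
Proof.
move=> pm qm; rewrite /degree_le msizeE; apply/bigmax_leqP_seq => k kpq _.
have /allpairsP[[k1 k2] /= [k1p k2q ->]] := msuppM_le kpq.
rewrite mdegD ltnS leq_add// -ltnS.
  exact: leq_trans (msize_mdeg_lt k1p) pm.
exact: leq_trans (msize_mdeg_lt k2q) qm.
Qed.

Lemma degree_leX (k : multinom 2) : degree_le (mdeg k) (mpolyX R k).
Proof. by rewrite /degree_le msizeX. Qed.

Lemma degree_leC m (c : R) : degree_le m (mpolyC 2 c).
Proof. by rewrite /degree_le msizeC; case: (c != 0). Qed.

(** * Elimination of the terms of highest degree *)

Lemma ord2P (i : 'I_2) : i = 0 \/ i = 1.
Proof. by case: i => [[|[|//]]] ?; [left|right]; apply/val_inj. Qed.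

(** The exponent of the monomial [x ^ i * y ^ j]. *)
Definition multinom2 (i j : nat) : multinom 2 := Multinom [tuple i; j].

Lemma multinom2E (k : multinom 2) : k = multinom2 (k 0) (k 1).
Proof.
apply/mnmP => i; rewrite [in RHS]mnm_tnth/=.
have [->|->] := ord2P i.
- by [].
- by rewrite !mnm_tnth.
Qed.

Lemma mdeg2 (k : multinom 2) : mdeg k = (k 0%R + k 1%R)%N.
Proof.
rewrite mdegE big_ord_recl big_ord1.
by rewrite (_ : lift _ _ = 1)//; apply/val_inj.
Qed.

(** A polynomial of degree at most [m] loses its terms of degree [m] after
    subtraction of a combination of the [P j], as soon as the homogeneous parts
    of degree [m] of these [m + 1] polynomials are independent: the square
    matrix of their coefficients is then invertible, and the combination solves
    a linear system. *)
Lemma degree_reduction m (P : 'I_m.+1 -> mpoly 2 R) p :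
  (forall j, degree_le m (P j)) ->
  (forall c : 'I_m.+1 -> R,
     (forall k, (m <= mdeg k)%N -> mcoeff k (\sum_j c j *: P j) = 0) ->
     forall j, c j = 0) ->
  degree_le m p ->
  exists c : 'I_m.+1 -> R,
    forall k, (m <= mdeg k)%N -> mcoeff k (p - \sum_j c j *: P j) = 0.
Proof.
move=> Pm Pfree pm.
have sm c : degree_le m (\sum_j c j *: P j).
  by apply: degree_le_sum => j _; apply: degree_leZ.
have topE (q : mpoly 2 R) : degree_le m q ->
    (forall i : 'I_m.+1, mcoeff (multinom2 i (m - i)) q = 0) ->
    forall k, (m <= mdeg k)%N -> mcoeff k q = 0.
  move=> /degree_leP qm q0 k.
  rewrite leq_eqVlt => /orP[/eqP mk|]; last exact: qm.
  have k0m : (k 0%R < m.+1)%N by rewrite ltnS mk mdeg2 leq_addr.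
  have kE : k = multinom2 (k 0) (m - k 0%R).
    by rewrite mk mdeg2 addKn -multinom2E.
  by rewrite kE; exact: (q0 (Ordinal k0m)).
pose A := \matrix_(j < m.+1, i < m.+1) mcoeff (multinom2 i (m - i)) (P j).
have AE (c : 'rV[R]_m.+1) i :
    (c *m A) 0 i = mcoeff (multinom2 i (m - i)) (\sum_j c 0 j *: P j).
  rewrite mxE (raddf_sum (mcoeff _)) /=; apply: eq_bigr => j _.
  by rewrite mxE mcoeffZ.
have Aunit : A \in unitmx.
  rewrite -row_free_unit; apply: inj_row_free => c cA0.
  apply/rowP => j; rewrite mxE; apply: (Pfree (fun j => c 0 j)).
  by apply: topE => // i; rewrite -AE cA0 mxE.
pose b := \row_(i < m.+1) mcoeff (multinom2 i (m - i)) p.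
exists (fun j => (b *m invmx A) 0 j); apply: topE.
  by apply: degree_leD => //; rewrite -scaleN1r; apply: degree_leZ.
by move=> i; rewrite mcoeffB -AE mulmxKV// mxE subrr.
Qed.

Definition reduces_degree m (P : 'I_m.+1 -> mpoly 2 R) : Prop :=
  forall p, degree_le m p ->
    exists c : 'I_m.+1 -> R, degree_le m.-1 (p - \sum_j c j *: P j).

Definition linearly_reducible m (P : 'I_m.+1 -> mpoly 2 R) p : Prop :=
  exists q : 'I_m.+1 -> mpoly 2 R,
    (forall j, degree_le 1 (q j)) /\ degree_le m.-1 (p - \sum_j q j * P j).

Lemma linearly_reducibleD m (P : 'I_m.+1 -> mpoly 2 R) p1 p2 :
  linearly_reducible P p1 -> linearly_reducible P p2 ->
  linearly_reducible P (p1 + p2).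
Proof.
move=> [q1 [q1l r1]] [q2 [q2l r2]]; exists (fun j => q1 j + q2 j); split.
  by move=> j; apply: degree_leD.
under eq_bigr do rewrite mulrDl.
by rewrite big_split/= opprD addrACA; apply: degree_leD.
Qed.

Lemma linearly_reducibleZ m (P : 'I_m.+1 -> mpoly 2 R) a p :
  linearly_reducible P p -> linearly_reducible P (a *: p).
Proof.
move=> [q [ql r]]; exists (fun j => a *: q j); split.
  by move=> j; apply: degree_leZ.
under eq_bigr do rewrite -scalerAl.
by rewrite -scaler_sumr -scalerBr; apply: degree_leZ.
Qed.

(** The possible quotients are closed under sums and scalings, so a single
    monomial is enough.  In degree [m + 1] it is [X_i * X^k'] with [X^k'] of
    degree [m]: reducing [X^k'] gives a remainder of degree [m - 1], whose
    product with [X_i] has degree [m] and is reduced a second time. *)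
Lemma reduces_degree_linearly m (P : 'I_m.+1 -> mpoly 2 R) p :
  (0 < m)%N -> reduces_degree P -> degree_le m.+1 p -> linearly_reducible P p.
Proof.
move=> m0 Pred pm; rewrite (mpolyE p).
rewrite big_seq; apply: big_ind => [||k kp].
- have zero_degree n : degree_le n (0 : mpoly 2 R).
    by rewrite -(mpolyC0 2); apply: degree_leC.
  exists (fun=> 0); split=> //.
  by rewrite big1 ?subr0// => j _; rewrite mul0r.
- exact: linearly_reducibleD.
apply: linearly_reducibleZ.
have : (mdeg k <= m.+1)%N.
  by rewrite -ltnS; apply: leq_trans (msize_mdeg_lt kp) pm.
rewrite leq_eqVlt ltnS => /orP[/eqP km|km]; last first.
  have [c cr] := Pred _ (degree_leW km (degree_leX k)).
  exists (fun j => mpolyC 2 (c j)); split=> [j|]; first exact: degree_leC.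
  by under eq_bigr do rewrite mul_mpolyC.
have [i ki] : exists i, k i != 0%N.
  case: (pselect (exists i, k i != 0%N)) => // /forallNP k0.
  move: km; rewrite mdegE big1// => i _.
  by have /negP := k0 i; rewrite negbK => /eqP.
have kE : k = mnm_add (mnm1 i) (mnm_sub k (mnm1 i)).
  apply/mnmP => j; rewrite mnmDE mnmBE mnm1E; case: eqP => [<-|_].
    by rewrite subnKC// lt0n.
  by rewrite subn0.
have k'm : mdeg (mnm_sub k (mnm1 i)) = m.
  by move: km; rewrite kE mdegD mdeg1 add1n => -[]; rewrite -kE.
have k'P : degree_le m (mpolyX R (mnm_sub k (mnm1 i))).
  by rewrite -[m in degree_le m _]k'm; apply: degree_leX.
have [c cr] := Pred _ k'P.
have Xir : degree_le m (mpolyX R (mnm1 i) *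
    (mpolyX R (mnm_sub k (mnm1 i)) - \sum_j c j *: P j)).
  have := degree_leM (degree_leX (mnm1 i)) cr.
  by rewrite mdeg1 add1n prednK.
have [c' c'r] := Pred _ Xir.
exists (fun j => c j *: mpolyX R (mnm1 i) + mpolyC 2 (c' j)); split.
  move=> j; apply: degree_leD; last exact: degree_leC.
  by apply: degree_leZ; have := degree_leX (mnm1 i); rewrite mdeg1.
move: c'r; congr (degree_le _ _).
under [in RHS]eq_bigr do rewrite mulrDl mul_mpolyC -scalerAl.
rewrite big_split/= opprD addrA; congr (_ - _).
rewrite [in RHS]kE mpolyXD mulrBr mulr_sumr.
by congr (_ - _); apply: eq_bigr => j _; rewrite -!mul_mpolyC mulrCA.
Qed.

Lemma affine_polyP p : degree_le 1 p -> exists a b c, p = affine_poly a b c.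
Proof.
move=> /degree_leP p1.
exists (mcoeff (mnm1 0) p), (mcoeff (mnm1 1) p), (mcoeff mnm0 p).
apply/mpolyP => k; rewrite /affine_poly !mcoeffD !mcoeffZ !mcoeffX mcoeffC.
have [k2|k1] := ltnP 1 (mdeg k).
  have neqk (l : multinom 2) : (mdeg l <= 1)%N -> (l == k) = false.
    by move=> l1; apply/eqP => lk; move: k2; rewrite -lk ltnNge l1.
  by rewrite p1// !neqk ?mdeg1// [k == _]eq_sym neqk ?mdeg0// !mulr0 !addr0.
have [/eqP|k0] := posnP (mdeg k).
  rewrite mdeg_eq0 => /eqP ->; rewrite !mnm1_eq0 eqxx.
  by rewrite !mulr0 mulr1 !add0r.
have /mdeg1P[i /eqP ->] : mdeg k == 1%N by rewrite eqn_leq k1.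
rewrite !eq_mnm1 mnm1_eq0 mulr0 addr0.
have [->|->] := ord2P i.
- by rewrite eqxx mulr0 addr0 mulr1.
- by rewrite eqxx mulr0 add0r mulr1.
Qed.

(** The quotients of the two highest degrees [2d + 1] and [2d] are found
    together, which is why only the even levels are used. *)
Lemma exists_even_expansion (P : forall m : nat, 'I_m.+1 -> mpoly 2 R) d p :
  (forall m, (0 < m)%N -> reduces_degree (P m)) ->
  degree_le (2 * d + 1) p ->
  exists (q : forall m : nat, 'I_m.+1 -> mpoly 2 R) (r : mpoly 2 R),
    even_expansion P d p q r.
Proof.
move=> Pred; elim: d p => [|d IH] p pd.
  exists (fun _ _ => 0), p; split=> //.
    by move=> k /andP[/leq_trans /[apply]].
  by rewrite big_geq// add0r.
have [q1 [q1l q1r]] : linearly_reducible (P (2 * d.+1)%N) p.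
  apply: reduces_degree_linearly => //; first exact: Pred.
  by move: pd; rewrite addn1.
have [|q [r [ql rl qr]]] := IH (p - \sum_j q1 j * P _ j).
  by apply: degree_leW q1r; rewrite mulnS addn1.
(* [inord] only converts the index type: when [m = 2 (d + 1)] it preserves the
   value of [j]. *)
exists (fun m (j : 'I_m.+1) =>
  if m == (2 * d.+1)%N then q1 (inord j) else q m j), r.
have qE k : (k <= d)%N -> ((2 * k)%N == (2 * d.+1)%N) = false.
  by move=> kd; rewrite eqn_mul2l/= ltn_eqF.
split=> //.
- move=> k /andP[k0]; rewrite leq_eqVlt => /orP[/eqP ->|].
    by rewrite eqxx => j.
  by rewrite ltnS => kd j; rewrite qE//; apply: ql; rewrite k0.
- rewrite big_nat_recr//= -[LHS](subrK (\sum_j q1 j * P _ j)) qr addrAC.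
  congr (_ + _ + _); last by apply: eq_bigr => j _; rewrite eqxx inord_val.
  by apply: eq_big_nat => k /andP[_ kd]; apply: eq_bigr => j _; rewrite qE.
Qed.
End Algebra.

(** * Polynomial functions on the plane *)

Section Polys.
Variable R : realType.
Implicit Types (p q : mpoly 2 R) (z : R * R) (a : R).

Lemma eval2D p q z : eval2 (p + q) z = eval2 p z + eval2 q z.
Proof. exact: mevalD. Qed.

Lemma eval2Z a p z : eval2 (a *: p) z = a * eval2 p z.
Proof. exact: mevalZ. Qed.

Lemma eval2M p q z : eval2 (p * q) z = eval2 p z * eval2 q z.
Proof. exact: mevalM. Qed.

Lemma eval2C a z : eval2 (mpolyC 2 a) z = a.
Proof. exact: mevalC. Qed.

Lemma eval2X (k : multinom 2) z :
  eval2 (mpolyX R k) z = z.1 ^+ k 0 * z.2 ^+ k 1.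
Proof.
rewrite /eval2 mevalX big_ord_recl big_ord1/=.
by rewrite (_ : lift _ _ = 1)//; apply/val_inj.
Qed.

Lemma eval2_affine (a b c : R) z :
  eval2 (affine_poly a b c) z = a * z.1 + b * z.2 + c.
Proof.
rewrite !eval2D !eval2Z eval2C !eval2X !mnm1E/=.
by rewrite !expr1 !expr0 mulr1 mul1r.
Qed.

Lemma eval2E p z :
  eval2 p z = \sum_(k <- msupp p) mcoeff k p * (z.1 ^+ k 0 * z.2 ^+ k 1).
Proof.
rewrite [in LHS](mpolyE p) /eval2 (raddf_sum (meval _)) /=.
by apply: eq_bigr => k _; rewrite mevalZ -eval2X.
Qed.

Lemma measurable_eval2 p : measurable_fun setT (eval2 p).
Proof.
rewrite (funext (eval2E p)).
apply: measurable_sum => k; apply: measurable_funM => //.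
by apply: measurable_funM; apply: measurable_funX.
Qed.

Lemma continuous_eval2 p : continuous (eval2 p).
Proof.
rewrite (funext (eval2E p)).
apply: continuous_big => [|k _ z]; first exact: add_continuous.
apply: cvgM; first exact: cvg_cst.
apply: cvgM.
- apply: (@continuous_comp _ _ _ fst (fun x : R => x ^+ k 0)).
    exact: cvg_fst.
  exact: exprn_continuous.
- apply: (@continuous_comp _ _ _ snd (fun x : R => x ^+ k 1)).
    exact: cvg_snd.
  exact: exprn_continuous.
Qed.

Lemma bounded_eval2 (A : set (R * R)) p :
  bounded_set A -> [bounded eval2 p z | z in A].
Proof.
move=> [M [_ MA]].
have {}MA z : A z -> `|z| <= `|M| + 1.
  by apply: MA; rewrite ltr_pwDr// ler_norm.
pose N := \sum_(k <- msupp p)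
  `|mcoeff k p| * ((`|M| + 1) ^+ k 0 * (`|M| + 1) ^+ k 1).
exists N; split; first exact: num_real.
move=> B NB z Az; apply: le_trans (ltW NB); rewrite eval2E.
apply: le_trans (ler_norm_sum _ _ _) _; apply: ler_sum => k _.
rewrite !normrM !normrX ler_wpM2l// ler_pM ?exprn_ge0//.
  rewrite lerXn2r ?nnegrE ?addr_ge0// (le_trans _ (MA _ Az))//.
  by rewrite prod_normE le_max lexx.
rewrite lerXn2r ?nnegrE ?addr_ge0// (le_trans _ (MA _ Az))//.
by rewrite prod_normE le_max lexx orbT.
Qed.

Lemma leb2_bounded_lty (A : set (R * R)) :
  measurable A -> bounded_set A -> (leb2 A < +oo)%E.
Proof.
move=> mA [M [_ MA]].
have {}MA z : A z -> `|z| <= `|M| + 1.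
  by apply: MA; rewrite ltr_pwDr// ler_norm.
pose I : set R := `[- (`|M| + 1), `|M| + 1]%classic.
have AI : A `<=` I `*` I.
  move=> z /MA; rewrite prod_normE ge_max => /andP[z1 z2].
  by split; rewrite /I/= in_itv/= -ler_norml.
have mI : measurable I by exact: measurable_itv.
rewrite /leb2; pose mu := (@lebesgue_measure R \x @lebesgue_measure R)%E.
apply: (@le_lt_trans _ _ (mu (I `*` I))).
  by apply: le_measure => //; rewrite inE//; apply: measurableX.
rewrite /mu product_measure1E//.
have muI : (@lebesgue_measure R I < +oo)%E.
  rewrite lebesgue_measure_itv/=.
  by case: ifP => _; rewrite ?ltry// -EFinB ltry.
by apply: lte_mul_pinfty => //; rewrite ge0_fin_numE.
Qed.

(** A nonzero [f] has fewer than [size f] roots, whereas the points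
    [x + r / (i + 2)] provide [size f] of them. *)
Lemma poly_eq0_itv (f : {poly R}) (x r : R) :
  0 < r -> (forall y, `|x - y| < r -> f.[y] = 0) -> f = 0.
Proof.
move=> r0 f0; apply/eqP/negPn/negP => fn0.
pose s := [seq x + r / i.+2%:R | i <- iota 0 (size f)].
have : (size s < size f)%N.
  apply: max_poly_roots => //.
    apply/allP => _ /mapP[i _ ->]; apply/eqP/f0.
    rewrite opprD addNKr normrN ger0_norm ?divr_ge0 ?ltW//.
    by rewrite ltr_pdivrMr// ltr_pMr// ltr1n.
  rewrite map_inj_uniq ?iota_uniq// => i j /addrI/(mulfI (lt0r_neq0 r0)).
  by move=> /invr_inj/eqP; rewrite eqr_nat => /eqP[].
by rewrite size_map size_iota ltnn.
Qed.

(** For fixed [y], the polynomial [A y] in the first variable vanishes on an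
    interval, so its coefficients are zero; the coefficient of [X^i] in it is
    the value at [y] of the polynomial [B i] in the second variable, which is
    therefore zero too.  The coefficients of the [B i] are those of [p]. *)
Lemma eval2_ball_eq0 p (w : R * R) (r : R) :
  0 < r -> (forall z, ball w r z -> eval2 p z = 0) -> p = 0.
Proof.
move=> r0 p0; apply/mpolyP => k0; rewrite mcoeff0.
pose A y := \sum_(k <- msupp p) (mcoeff k p * y ^+ k 1) *: 'X^(k 0) : {poly R}.
pose B i := \sum_(k <- msupp p)
  (if k 0 == i then mcoeff k p else 0) *: 'X^(k 1) : {poly R}.
have A0 y : `|w.2 - y| < r -> A y = 0.
  move=> yw; apply: (@poly_eq0_itv _ w.1 r) => // x xw.
  transitivity (eval2 p (x, y)).
  2: by apply: p0; split; rewrite /= -ball_normE.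
  rewrite eval2E /A horner_sum; apply: eq_bigr => k _.
  by rewrite hornerZ hornerXn/= mulrAC mulrA.
have B0 i : B i = 0.
  apply: (@poly_eq0_itv _ w.2 r) => // y yw.
  transitivity ((A y)`_i); last by rewrite A0// coef0.
  rewrite coef_sum horner_sum; apply: eq_bigr => k _.
  rewrite hornerZ hornerXn coefZ coefXn eq_sym.
  by case: eqP => _; rewrite ?mulr1// mul0r mulr0.
transitivity ((B (k0 0))`_(k0 1)); last by rewrite B0 coef0.
rewrite coef_sum.
rewrite [in LHS](mpolyE p) (raddf_sum (mcoeff _)) /=; apply: eq_bigr => k _.
rewrite mcoeffZ mcoeffX coefZ coefXn.
have -> : (k == k0) = (k 0 == k0 0) && (k0 1 == k 1).
  apply/eqP/andP => [->|[/eqP k00 /eqP k01]]; first by rewrite !eqxx.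
  by rewrite [k]multinom2E [k0]multinom2E k00 k01.
by case: (k 0 == k0 0); rewrite ?mul0r ?mulr0.
Qed.

(** * Integrals of polynomials over a bounded set *)

Section Integral.
Variable Omega : set (R * R).
Hypothesis mO : measurable Omega.
Hypothesis bO : bounded_set Omega.

Lemma integrable_eval2 p :
  (@leb2 R).-integrable Omega (EFin \o eval2 p).
Proof.
apply: measurable_bounded_integrable => //.
- exact: leb2_bounded_lty.
- exact: measurable_funTS (measurable_eval2 p).
- exact: bounded_eval2.
Qed.

Let I p := integral2 Omega (eval2 p).

Lemma integral2_eval2D p q : I (p + q) = I p + I q.
Proof.
rewrite /I /integral2 -RintegralD//; last 2 first.
- exact: integrable_eval2.
- exact: integrable_eval2.
by apply: eq_Rintegral => z _; rewrite eval2D.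
Qed.

Lemma integral2_eval2Z a p : I (a *: p) = a * I p.
Proof.
rewrite /I /integral2 -RintegralZl//; last exact: integrable_eval2.
by apply: eq_Rintegral => z _; rewrite eval2Z.
Qed.

Lemma integral2_eval2C a : I (mpolyC 2 a) = a * area Omega.
Proof.
rewrite /I /integral2 /area -Rintegral_cst//.
by apply: eq_Rintegral => z _; rewrite eval2C.
Qed.

Lemma integral2_eval2_sum (J : Type) (s : seq J) (Q : pred J)
    (F : J -> mpoly 2 R) :
  I (\sum_(i <- s | Q i) F i) = \sum_(i <- s | Q i) I (F i).
Proof.
apply: (big_morph I integral2_eval2D).
by rewrite -(mpolyC0 2) integral2_eval2C mul0r.
Qed.

Lemma poly_innerE p q : poly_inner Omega p q = I (p * q).
Proof. by apply: eq_Rintegral => z _; rewrite eval2M. Qed.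

Lemma integral2_affine (a b c : R) :
  I (affine_poly a b c) =
  a * integral2 Omega (fun z => z.1) + b * integral2 Omega (fun z => z.2)
  + c * area Omega.
Proof.
rewrite /affine_poly !integral2_eval2D !integral2_eval2Z integral2_eval2C.
by congr (_ * _ + _ * _ + _); apply: eq_Rintegral => z _;
  rewrite eval2X !mnm1E/= expr1 expr0 ?mulr1 ?mul1r.
Qed.

(** Positive definiteness of the inner product.  A nonzero [g] does not vanish
    at some point of [U]; by continuity [g ^ 2] exceeds a positive constant on
    a small square around it, and the integral is at least that constant times
    the area of the square. *)
Lemma integral2_sqr_eq0 (U : set (R * R)) g :
  open U -> U !=set0 -> U `<=` Omega -> poly_inner Omega g g = 0 -> g = 0.
Proof.
move=> oU [w Uw] UO; rewrite poly_innerE => g0.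
apply/eqP/negPn/negP => /eqP gn0.
have [r /= r0 rU] : exists2 r : R, 0 < r & ball w r `<=` U.
  by have /nbhs_ballP[r /= r0 rU] := open_nbhs_nbhs (conj oU Uw); exists r.
have [z Uz gz] : exists2 z, U z & eval2 g z != 0.
  apply: contrapT => /forall2NP gz; apply: gn0.
  apply: (eval2_ball_eq0 r0) => z /rU Uz.
  by have [//|/negP] := gz z; rewrite negbK => /eqP.
pose h := eval2 (g * g).
have h_ge0 z' : 0 <= h z' by rewrite /h eval2M -expr2 sqr_ge0.
have hz : 0 < h z / 2.
  by rewrite divr_gt0// lt0r h_ge0 andbT /h eval2M mulf_neq0.
have [e /= e0 eV] : exists2 e : R, 0 < e &
    ball z e `<=` U `&` [set z' | h z / 2 < h z'].
  have : nbhs z (U `&` [set z' | h z / 2 < h z']).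
    apply: filterI; first exact: open_nbhs_nbhs.
    apply: (@continuous_eval2 (g * g) z [set x | h z / 2 < x]).
    apply: open_nbhs_nbhs; split; first exact: open_gt.
    rewrite /= -/(h z) gtr_pMr ?invf_lt1 ?ltr1n//.
    by move: hz; rewrite pmulr_lgt0.
  by case/nbhs_ballP => e /= e0 eV; exists e.
pose B : set (R * R) := ball z.1 e `*` ball z.2 e.
have BV : B `<=` U `&` [set z' | h z / 2 < h z'].
  by move=> z' [z'1 z'2]; apply: eV.
have mB : measurable B by apply: measurableX; exact: measurable_ball.
pose mu := (@lebesgue_measure R \x @lebesgue_measure R)%E.
have intO : (\int[mu]_(z' in Omega) (h z')%:E = 0)%E.
  rewrite -[RHS](congr1 EFin g0) fineK//.
  exact: (integrable_fin_num _ (integrable_eval2 (g * g))).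
have : ((h z / 2)%:E * mu B <= 0)%E.
  rewrite -intO -integral_cst//.
  apply: (@le_trans _ _ (\int[mu]_(z' in B) (h z')%:E)%E).
    apply: ge0_le_integral => //.
    - by move=> ? _; rewrite /= lee_fin ltW.
    - by apply/measurable_EFinP; exact: measurable_funTS (measurable_eval2 _).
    - by move=> z' /BV[_ /ltW]; rewrite /= lee_fin.
  apply: ge0_subset_integral => //.
  - apply/measurable_EFinP; exact: measurable_funTS (measurable_eval2 _).
  - by move=> *; rewrite lee_fin.
  - by move=> z' /BV[/UO].
apply/negP; rewrite -ltNge mule_gt0 ?lte_fin//.
rewrite /mu /B product_measure1E; try exact: measurable_ball.
by apply: mule_gt0; rewrite /= lebesgue_measure_ball ?ltW// lte_fin mulrn_wgt0.
Qed.

(** The reflection [z |-> - z] preserves the product measure, since it preserves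
    the measure of rectangles, and it maps [Omega] to itself.  So the integral
    of an odd function equals its own opposite. *)
Lemma integral2_odd p :
  centrally_symmetric Omega ->
  (forall z, eval2 p (- z.1, - z.2) = - eval2 p z) -> I p = 0.
Proof.
move=> Osym podd.
pose mu := (@lebesgue_measure R \x @lebesgue_measure R)%E.
pose T := (measurableTypeR R * measurableTypeR R)%type.
pose opp (z : T) : T := (- z.1, - z.2).
have mopp : measurable_fun [set: T] opp.
  apply: measurable_fun_pair; exact: measurableT_comp.
have muN (X : set T) : measurable X -> mu X = pushforward mu opp X.
  move=> mX; apply: product_measure_unique => // A B mA mB.
  have mN (C : set R) : measurable C -> measurable ((-%R : R -> R) @^-1` C).
    by move=> mC; rewrite -[X in measurable X]setTI; exact: oppr_measurable.
  transitivity (mu ((-%R @^-1` A) `*` (-%R @^-1` B))); first by [].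
  rewrite /mu product_measure1E; [|exact: mN|exact: mN].
  by congr (_ * _)%E; exact: lebesgue_measureN.
have OE : opp @^-1` Omega = Omega.
  apply/seteqP; split=> -[x y] /= => [/Osym|/Osym//].
  by rewrite !opprK.
have INI : I p = - I p.
  rewrite -[RHS]mulN1r -integral2_eval2Z; congr fine.
  transitivity (\int[pushforward mu opp]_(z in Omega) (eval2 p z)%:E)%E.
    by apply: eq_measure_integral => /= A mA _; exact: muN.
  rewrite integral_pushforward//; last 2 first.
  - by apply/measurable_EFinP; exact: measurable_eval2.
  - rewrite OE (_ : _ \o _ = EFin \o eval2 (- 1 *: p)); last first.
      by apply/funext => z /=; rewrite podd eval2Z mulN1r.
    exact: integrable_eval2.
  rewrite OE; apply: eq_integral => z _ /=.
  by rewrite podd eval2Z mulN1r.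
by apply/eqP; rewrite -eqNr -INI.
Qed.

Lemma integral2_affine_symmetric (a b c : R) :
  centrally_symmetric Omega -> I (affine_poly a b c) = c * area Omega.
Proof.
move=> Osym; have odd0 : I (affine_poly a b 0) = 0.
  apply: integral2_odd => // z.
  by rewrite !eval2_affine/= !addr0 !mulrN opprD.
move: odd0; rewrite !integral2_affine mul0r addr0 => ->.
by rewrite add0r.
Qed.

(** * The expansion in orthogonal polynomials of even degree *)

(** A combination of the [P j] of degree below [m] is orthogonal to each [P j],
    hence to itself, and vanishes by positive definiteness; so the homogeneous
    parts of degree [m] of the [P j] are independent. *)
Lemma orthogonal_basis_reduces (U : set (R * R)) m (P : 'I_m.+1 -> mpoly 2 R) :
  open U -> U !=set0 -> U `<=` Omega ->
  (0 < m)%N -> orthogonal_basis Omega P -> reduces_degree P.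
Proof.
move=> oU U0 UO m0 [Porth _ Pfree _] p pm.
have low q : (forall k, (m <= mdeg k)%N -> mcoeff k q = 0) -> degree_le m.-1 q.
  by move=> q0; apply/degree_leP => k; rewrite prednK//; apply: q0.
have [j|c c0|c cr] := @degree_reduction R m P p _ _ pm.
- by have [] := Porth j.
- apply: Pfree; set g := \sum_j c j *: P j.
  apply: (integral2_sqr_eq0 oU U0 UO).
  rewrite poly_innerE {1}/g mulr_suml integral2_eval2_sum big1// => j _.
  rewrite -scalerAl integral2_eval2Z -poly_innerE.
  by have [_ ->] := Porth j; rewrite ?mulr0//; apply: low.
- by exists c; apply: low.
Qed.

(** Every term [q * P_(2k,j)] is the inner product of [P_(2k,j)] with a
    polynomial of lower degree. *)
Lemma integral2_expansion (P q : forall m : nat, 'I_m.+1 -> mpoly 2 R) d p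
    (r : mpoly 2 R) :
  (forall m, (0 < m)%N -> orthogonal_basis Omega (P m)) ->
  even_expansion P d p q r -> I p = I r.
Proof.
move=> hP [qlin _ ->]; rewrite integral2_eval2D integral2_eval2_sum.
rewrite big_nat_cond big1 ?add0r// => k /andP[/andP[k0 kd] _].
rewrite integral2_eval2_sum big1// => j _.
have [|Porth _ _ _] := hP (2 * k)%N; first by rewrite muln_gt0.
have [_ Pj0] := Porth j; rewrite mulrC -poly_innerE; apply: Pj0.
(* A linear factor has degree at most [2 * k - 1] because [1 <= k]. *)
apply: degree_leW (qlin k _ j); last by rewrite k0.
by case: k k0 {kd j Porth} => // k _; rewrite mulnS.
Qed.

End Integral.
End Polys.

Theorem theorem4p7 (R : realType) (Omega : set (R * R))
    (P : forall m : nat, 'I_m.+1 -> mpoly 2 R)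
    (n d : nat) (Pn : mpoly 2 R)
    (hOmega : bounded_domain Omega)
    (hP : forall m : nat, (1 <= m)%N -> orthogonal_basis Omega (P m))
    (hd : (1 <= d)%N)
    (hn : (2 * d <= n <= 2 * d + 1)%N)
    (hPn : msize Pn = n.+1) :
  (exists (q : forall m : nat, 'I_m.+1 -> mpoly 2 R) (a b c : R),
      even_expansion P d Pn q (affine_poly a b c)) /\
  (forall (q : forall m : nat, 'I_m.+1 -> mpoly 2 R) (a b c : R),
      even_expansion P d Pn q (affine_poly a b c) ->
      (centrally_symmetric Omega ->
         integral2 Omega (eval2 Pn) = c * area Omega) /\
      (polygonal_domain Omega ->
         integral2 Omega (eval2 Pn) =
           a * integral2 Omega (fun z => z.1) +
           b * integral2 Omega (fun z => z.2) +
           c * area Omega)).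
Proof.
have [mO bO [U [oU _ U0 UO _]]] := hOmega.
split.
  have [||q [r Pnqr]] := @exists_even_expansion R P d Pn.
  - move=> m m0; apply: (orthogonal_basis_reduces mO bO oU U0 UO m0).
    exact: hP.
  - by rewrite /degree_le hPn ltnS; case/andP: hn.
  have [_ r1 _] := Pnqr; have [a [b [c rE]]] := affine_polyP r1.
  by exists q, a, b, c; rewrite -rE.
move=> q a b c Pnq; rewrite (integral2_expansion mO bO hP Pnq); split.
- exact: integral2_affine_symmetric.
- by move=> _; exact: integral2_affine.
Qed.
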